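(* Let $\tau$ be a permutation and let $\gamma_1, \gamma_2, \ldots$ be a convergent sequence of permutations. Then the sequence of tensor products $\tau[\gamma_1], \tau[\gamma_2], \ldots$ is also convergent. Furthermore, for every permutation (pattern) $\pi$, the limit density of $\pi$ in this sequence is $$\lim_{j\to\infty} t(\pi, \tau[\gamma_j]) = \frac{|\pi|!}{|\tau|^{|\pi|}} \sum_{(\sigma, b) \in B(\pi)} \left( \binom{|\tau|}{|\sigma|}\, t(\sigma, \tau) \cdot \prod_{i=1}^{|\sigma|} \frac{\lim_{j\to\infty} t(b_i, \gamma_j)}{|b_i|!} \right).$$
   Context: A permutation of length $n\ge 1$ is a bijection of $[n]=\{1,\dots,n\}$, written as the tuple of its values; $S_n$ is the set of these and $|\tau|$ denotes the length of $\tau$. A tuple $(a_1,\dots,a_k)$ of distinct integers is order-isomorphic to $\pi\in S_k$ if $a_i<a_j \iff \pi(i)<\pi(j)$ for all $i,j$. Density: for $\pi\in S_k$ and a permutation $\tau$ with $|\tau|\ge k$, $t(\pi,\tau)$ is the probability that the restriction of $\tau$ to a uniformly random $k$-element subset of its indices (listed in increasing order of index) is order-isomorphic to $\pi$. When $|\tau|<k$, the product $\binom{|\tau|}{k}t(\pi,\tau)$ is interpreted as $0$ (e.g. by setting $t(\pi,\tau)=0$). Convergent sequence: a sequence of permutations $\{\tau_j\}$ is convergent if $|\tau_j|\to\infty$ and, for every permutation $\pi$, the real sequence $t(\pi,\tau_j)$ converges; its limit is called the limit density of $\pi$ in $\{\tau_j\}$. Inflation: for $\tau\in S_n$ and permutations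 $\gamma_1,\dots,\gamma_n$ (each of length at least $1$), $\tau[\gamma_1,\dots,\gamma_n]$ is the permutation of length $|\gamma_1|+\cdots+|\gamma_n|$ consisting of $n$ consecutive blocks of indices, the $i$-th of length $|\gamma_i|$, such that the $i$-th block is order-isomorphic to $\gamma_i$ and every restriction to one element from each block is order-isomorphic to $\tau$. Tensor product: $\tau[\gamma]=\tau[\gamma,\dots,\gamma]$; that is, for $\tau\in S_n$, $\gamma\in S_m$, $\tau[\gamma]((i-1)m+j)=(\tau(i)-1)m+\gamma(j)$ for $i\in[n]$, $j\in[m]$. Block decomposition: a block decomposition of $\pi$ of order $\ell$ is a pair $(\sigma,b)$ with $\sigma\in S_\ell$ and $b=(b_1,\dots,b_\ell)$ a sequence of permutations such that $\pi=\sigma[b_1,\dots,b_\ell]$. $B(\pi)$ denotes the set of all block decompositions of $\pi$ (of all orders). *)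

(* Defs.v *)
From HB Require Import structures.
From mathcomp Require Import all_boot all_order all_algebra all_fingroup.
From mathcomp Require Import zify.
From mathcomp Require Import all_classical all_reals all_analysis.

Set Implicit Arguments.
Unset Strict Implicit.
Unset Printing Implicit Defensive.

Import Order.TTheory GRing.Theory Num.Theory.
Import numFieldNormedType.Exports.

Local Open Scope classical_set_scope.
Local Open Scope ring_scope.

(* Permutations of all lengths [n.+1 >= 1]; indices and values are 0-based. *)
Definition permutation : Type := {n : nat & 'S_n.+1}.

Definition plen (pi : permutation) : nat := (tag pi).+1.

Definition papp (pi : permutation) : {perm 'I_(plen pi)} := tagged pi.

Definition word (pi : permutation) : seq nat :=
  [seq val (papp pi i) | i <- enum 'I_(plen pi)].

Definition order_iso (a : seq nat) (pi : permutation) : bool :=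
  (size a == plen pi) &&
  [forall i : 'I_(plen pi), forall j : 'I_(plen pi),
     (nth 0 a i < nth 0 a j)%N == (papp pi i < papp pi j)%N].

(* [enum A] lists the elements of [A] in increasing order. *)
Definition restriction (tau : permutation) (A : {set 'I_(plen tau)}) : seq nat :=
  [seq val (papp tau i) | i <- enum A].

(* When [plen tau < plen pi] this is [0 / 0 = 0]. *)
Definition density (R : realType) (pi tau : permutation) : R :=
  #|[set A : {set 'I_(plen tau)} |
      (#|A| == plen pi) && order_iso (restriction A) pi]%SET|%:R
  / 'C(plen tau, plen pi)%:R.

Definition convergent (R : realType) (tau : nat -> permutation) : Prop :=
  plen (tau j) @[j --> \oo] --> \oo /\
  forall pi : permutation, cvgn (fun j => density R pi (tau j)).

Definition limit_density (R : realType) (pi : permutation)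
    (tau : nat -> permutation) : R :=
  limn (fun j => density R pi (tau j)).

(* [is_inflation tau gs pi] says that [pi] is [tau[g_1, ..., g_n]] with
   [gs = [:: g_1; ...; g_n]].  [reshape] cuts the one-line word of [pi] into
   consecutive blocks of the prescribed lengths. *)
Definition is_inflation (tau : permutation) (gs : seq permutation)
    (pi : permutation) : Prop :=
  let blocks := reshape (map plen gs) (word pi) in
  [/\ size gs = plen tau,
      plen pi = sumn (map plen gs),
      all2 order_iso blocks gs
    & forall c : seq nat, all2 (fun x B => x \in B) c blocks ->
        order_iso c tau].

Definition block_decompositions (pi : permutation) :
    set (permutation * seq permutation) :=
  [set d | is_inflation d.1 d.2 pi].

Section Tensor.
Variables (n m : nat) (tau : 'S_n.+1) (gamma : 'S_m.+1).

Lemma tensor_subproof (x : 'I_(n.+1 * m.+1)) :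
  (tau (inord (x %/ m.+1)) * m.+1 + gamma (inord (x %% m.+1)) < n.+1 * m.+1)%N.
Proof.
move: (tau _) (gamma _) => i j.
apply: (@leq_trans (i.+1 * m.+1)); first by rewrite mulSn addnC ltn_add2r.
by rewrite leq_mul2r ltn_ord orbT.
Qed.

Definition tensor_fun (x : 'I_(n.+1 * m.+1)) : 'I_(n.+1 * m.+1) :=
  Ordinal (tensor_subproof x).

Lemma tensor_fun_inj : injective tensor_fun.
Proof.
move=> x y /(congr1 val) /= e.
have xn z : (z < n.+1 * m.+1 -> z %/ m.+1 < n.+1)%N by rewrite ltn_divLR.
have /(congr1 (fun z => z %/ m.+1)%N) := e.
rewrite !divnMDl // !(divn_small (ltn_ord _)) !addn0.
move=> /val_inj/perm_inj/(congr1 val) /=; rewrite !inordK ?xn // => ed.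
have /(congr1 (fun z => z %% m.+1)%N) := e.
rewrite !modnMDl !(modn_small (ltn_ord _)).
move=> /val_inj/perm_inj/(congr1 val) /=; rewrite !inordK ?ltn_pmod // => em.
by apply: val_inj; rewrite /= (divn_eq x m.+1) ed em -divn_eq.
Qed.

End Tensor.

(* [(n.+1 * m.+1).-1.+1] and [n.+1 * m.+1] are convertible. *)
Definition tensor (tau gamma : permutation) : permutation :=
  Tagged (fun n => 'S_n.+1) (i := (plen tau * plen gamma).-1)
    (perm (@tensor_fun_inj (tag tau) (tag gamma) (tagged tau) (tagged gamma))).

Lemma size_word (pi : permutation) : size (word pi) = plen pi.
Proof. by rewrite size_map size_enum_ord. Qed.

Lemma word_iota (pi : permutation) :
  word pi = [seq val (papp pi (inord k)) | k <- iota 0 (plen pi)].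
Proof.
rewrite /word -val_enum_ord -map_comp; apply: eq_map => i /=.
by rewrite inord_val.
Qed.

Lemma nth_word (pi : permutation) (i : 'I_(plen pi)) :
  nth 0%N (word pi) i = papp pi i.
Proof. by rewrite (nth_map i) ?size_enum_ord // nth_ord_enum. Qed.

Lemma tensorE (tau gamma : permutation) (i : 'I_(plen tau))
    (j : 'I_(plen gamma)) (x : 'I_(plen (tensor tau gamma))) :
  x = (i * plen gamma + j)%N :> nat ->
  papp (tensor tau gamma) x = (papp tau i * plen gamma + papp gamma j)%N :> nat.
Proof.
move=> xE; rewrite /papp permE /= xE divnMDl // modnMDl.
by rewrite divn_small ?modn_small // addn0 !inord_val.
Qed.

Lemma word_tensor (tau gamma : permutation) :
  word (tensor tau gamma) =
  flatten [seq [seq (x * plen gamma + y)%N | y <- word gamma] | x <- word tau].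
Proof.
have io a b : iota 0 (a * b) =
    flatten [seq [seq (x * b + y)%N | y <- iota 0 b] | x <- iota 0 a].
  elim: a => // a IH; rewrite -addn1 iotaD map_cat flatten_cat -IH /= cats0.
  by rewrite mulnDl mul1n iotaD !add0n -[X in iota X b]addn0 iotaDl.
rewrite !word_iota.
rewrite (io (plen tau) (plen gamma) : iota 0 (plen (tensor tau gamma)) = _).
rewrite map_flatten -!map_comp; congr flatten.
apply/eq_in_map => i; rewrite mem_iota add0n => /andP[_ lti].
rewrite [LHS]/comp [RHS]/comp -!map_comp.
apply/eq_in_map => j; rewrite mem_iota add0n => /andP[_ ltj].
apply: (@tensorE tau gamma (inord i) (inord j)).
rewrite !inordK //.
have lt1 : (i * plen gamma + j < i.+1 * plen gamma)%N.
  by rewrite mulSn addnC ltn_add2r.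
apply: leq_trans lt1 _.
change (i.+1 * plen gamma <= plen tau * plen gamma)%N.
by rewrite leq_mul2r lti orbT.
Qed.

Lemma tensor_inflation (tau gamma : permutation) :
  is_inflation tau (nseq (plen tau) gamma) (tensor tau gamma).
Proof.
pose F x := [seq (x * plen gamma + y)%N | y <- word gamma].
have blE : reshape (map plen (nseq (plen tau) gamma)) (word (tensor tau gamma))
    = map F (word tau).
  rewrite word_tensor -/F -[RHS]flattenK; congr (reshape _ _).
  rewrite /shape -map_comp map_nseq -(size_word tau).
  by elim: (word tau) => //= x s ->; rewrite size_map size_word.
have wlt y : y \in word gamma -> (y < plen gamma)%N.
  by case/mapP => i _ ->; exact: ltn_ord.
split; rewrite ?blE ?size_nseq //.
- by rewrite map_nseq sumn_nseq mulnC.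
- rewrite -(size_word tau); elim: (word tau) => //= x s ->; rewrite andbT.
  rewrite /order_iso size_map size_word eqxx /=.
  apply/forallP => i; apply/forallP => j.
  by rewrite !(nth_map 0%N) ?size_word // ltn_add2l !nth_word eqxx.
- move=> c cP.
  have [sz nP] : size c = size (word tau) /\ forall i, (i < size (word tau))%N ->
      exists2 y, (y < plen gamma)%N &
        nth 0%N c i = (nth 0 (word tau) i * plen gamma + y)%N.
    elim: (word tau) c cP => [|x s IH] [|z c] //= /andP[/mapP[y /wlt y_lt zE]].
    move=> /IH[-> nP]; split => // -[_|i lti] /=; first by exists y.
    exact: nP.
  rewrite /order_iso sz size_word eqxx /=.
  apply/forallP => i; apply/forallP => j.
  have [->|ij] := eqVneq i j; first by rewrite !ltnn.
  have [|y ylt ->] := nP i; first by rewrite size_word.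
  have [|z zlt ->] := nP j; first by rewrite size_word.
  rewrite !nth_word.
  have : papp tau i != papp tau j by rewrite (inj_eq perm_inj).
  rewrite -val_eqE /=; apply: contraNT.
  by move: ylt zlt; move: (papp tau i : nat) (papp tau j : nat) => a b; nia.
Qed.

(* Finiteness matters because [\sum_(d \in B)] is [0] over infinite support. *)
Lemma finite_block_decompositions (pi : permutation) :
  finite_set (block_decompositions pi).
Proof.
pose T : finType := {i : 'I_(plen pi) & 'S_i.+1}.
pose f (x : T) : permutation := Tagged (fun n => 'S_n.+1) (tagged x).
have fP (s : permutation) : (plen s <= plen pi)%N -> exists x, f x = s.
  case: s => n s lt_n.
  by exists (Tagged (fun i : 'I_(plen pi) => 'S_i.+1) (i := Ordinal lt_n) s).
pose g (x : T * (plen pi).-bseq T) := (f x.1, map f x.2).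
apply: (@sub_finite_set _ _ (g @` setT)); last first.
  exact/finite_image/finite_finset.
move=> [s b] [/= sz_b len_pi _ _].
have sz_le (c : seq permutation) : (size c <= sumn (map plen c))%N.
  by elim: c => //= x c IH; rewrite addSn ltnS (leq_trans IH) ?leq_addl.
have [|s' s'E] := fP s; first by rewrite -sz_b len_pi sz_le.
have [b' b'E] : exists b', map f b' = b.
  have: (sumn (map plen b) <= plen pi)%N by rewrite len_pi.
  elim: (b) => [|x c IH] /=; first by exists [::].
  move=> le; have [|c' <-] := IH; first by rewrite (leq_trans _ le) ?leq_addl.
  have [|x' <-] := fP x; first by rewrite (leq_trans _ le) ?leq_addr.
  by exists (x' :: c').
have sz_b' : (size b' <= plen pi)%N by rewrite -(size_map f) b'E len_pi sz_le.
by exists (s', Bseq sz_b') => //; rewrite /g /= s'E b'E.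
Qed.

(* Main.v *)
Require Import Defs.
From HB Require Import structures.
From mathcomp Require Import all_boot all_order all_algebra all_fingroup.
From mathcomp Require Import all_classical all_reals all_analysis.
From mathcomp Require Import zify finmap.

Import Order.TTheory GRing.Theory Num.Theory.
Import numFieldNormedType.Exports.

(** The proof counts occurrences instead of densities.  Let N(p, w) be the
    number of subsequences of the word w that are order-isomorphic to p, so that
    N(p, tau) = binom(|tau|, |p|) t(p, tau).  The word of tau[gamma] is a
    concatenation of translated copies of the word of gamma, one for each entry
    of tau.  A subsequence of it is therefore the same thing as a subsequence t
    of tau (the copies that it meets) together with a nonempty subsequence c_i
    of gamma for each entry of t; this is [sum_subs_flatten].  If sigma is the
    pattern of t and b_i that of c_i, then the whole subsequence has pattern
    sigma[b_1, ..., b_l], hence it is an occurrence of pi exactly when (sigma, b)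
    is a block decomposition of pi ([order_iso_flatten]).  As every nonempty word
    without repetition has exactly one pattern, sorting the occurrences of pi by
    (sigma, b) gives the exact identity [occurrences_tensor]:

      N(pi, tau[gamma]) = sum over (sigma, b) in B(pi) of
                          N(sigma, tau) * prod_i N(b_i, gamma).

    The rest is a passage to the limit.  Let m = |gamma| grow.  The lengths |b_i|
    add up to k = |pi|, so the factor m^k distributes over the blocks, and
    binom(m, r) / m^r tends to 1 / r! ([cvg_binomial_expn]): each
    N(b_i, gamma) / m^|b_i| tends to (lim t(b_i, gamma)) / |b_i|!, while
    (m |tau|)^k / binom(m |tau|, k) tends to k!.  Since B(pi) is finite, the
    limit may be taken term by term. *)

(** * Sums over the subsequences of a concatenation *)

Section Subsequences.
Local Open Scope nat_scope.

(** Subsequences are listed with multiplicity, one for each set of positions;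
    this is what makes sums over [subs] additive and multiplicative under
    concatenation without any hypothesis on the word. *)
Fixpoint subs {T : Type} (s : seq T) : seq (seq T) :=
  if s is x :: s' then map (cons x) (subs s') ++ subs s' else [:: [::]].

Definition nonempty_subs {T : eqType} (s : seq T) : seq (seq T) :=
  [seq u <- subs s | u != [::]].

Fixpoint choices {T : Type} (ss : seq (seq T)) : seq (seq T) :=
  if ss is s :: ss' then [seq x :: c | x <- s, c <- choices ss'] else [:: [::]].

Lemma mem_subs {T : eqType} (s u : seq T) : (u \in subs s) = subseq u s.
Proof.
elim: s u => [|x s IH] u /=; first by rewrite inE; case: u.
rewrite mem_cat IH; case: u => [|y u]; first by rewrite sub0seq orbT.
have inj : injective (cons x) by move=> ? ? [].
case: eqVneq => [->|ne]; first rewrite (mem_map inj) IH.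
  rewrite orb_idr // => h; apply: subseq_trans h; exact: subseq_cons.
rewrite [X in X || _](_ : _ = false) //; apply/mapP => -[v _ [e _]].
by rewrite e eqxx in ne.
Qed.

Lemma subs_uniq {T : eqType} (s : seq T) : uniq s -> uniq (subs s).
Proof.
elim: s => //= x s IH /andP[xs /IH us].
have inj : injective (cons x) by move=> ? ? [].
rewrite cat_uniq (map_inj_uniq inj) us /= andbT.
apply/hasPn => u; rewrite mem_subs => us'; apply/mapP => -[v _ e].
by move: xs; rewrite (mem_subseq us') // e mem_head.
Qed.

Lemma subs_map {T U : Type} (f : T -> U) (s : seq T) :
  subs (map f s) = map (map f) (subs s).
Proof.
by elim: s => //= x s ->; rewrite map_cat -!map_comp.
Qed.

Lemma sum_subs_cat {T : Type} (s t : seq T) (F : seq T -> nat) :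
  \sum_(w <- subs (s ++ t)) F w =
  \sum_(u <- subs s) \sum_(v <- subs t) F (u ++ v).
Proof.
elim: s F => [|x s IH] F /=; first by rewrite big_seq1.
by rewrite !big_cat !big_map /= !IH.
Qed.

Lemma sum_subs_nil {T : eqType} (s : seq T) (F : seq T -> nat) :
  \sum_(u <- subs s) F u = F [::] + \sum_(u <- nonempty_subs s) F u.
Proof.
rewrite big_filter.
elim: s => [|x s IH] /=; first by rewrite big_seq1 big_cons big_nil /= addn0.
by rewrite !big_cat !big_map /= IH addnCA.
Qed.

Lemma sum_choices_cons {T : Type} (s : seq T) ss (F : seq T -> nat) :
  \sum_(c <- choices (s :: ss)) F c =
  \sum_(x <- s) \sum_(c <- choices ss) F (x :: c).
Proof. by rewrite /= big_allpairs_dep. Qed.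

Lemma mem_choices {T : eqType} (ss : seq (seq T)) c :
  c \in choices ss -> all2 (fun x s => x \in s) c ss.
Proof.
elim: ss c => [|s ss IH] c /=; first by rewrite inE => /eqP->.
by move=> /allpairsP[[x c'] /= [xs /IH c's ->]] /=; rewrite xs.
Qed.

(** Each piece [G x] is either missed by the subsequence, and then [x] is not in
    [t], or met in a nonempty subsequence.  Only nonempty pieces are allowed in
    the choice, since otherwise the same subsequence would be counted for
    several [t]. *)
Lemma sum_subs_flatten {S : Type} {T : eqType} (G : S -> seq T) (s : seq S)
    (F : seq T -> nat) :
  \sum_(w <- subs (flatten (map G s))) F w =
  \sum_(t <- subs s) \sum_(c <- choices [seq nonempty_subs (G x) | x <- t])
    F (flatten c).
Proof.
elim: s F => [|x s IH] F; first by rewrite /= !big_seq1.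
rewrite /= sum_subs_cat sum_subs_nil big_cat big_map /= addnC IH; congr (_ + _).
under eq_bigr do rewrite IH.
rewrite exchange_big; apply: eq_bigr => t _.
by rewrite big_allpairs_dep.
Qed.

(** The choices are independent, so the number of compatible ones is a product.
    The counts [K] do not depend on [x]: in the application the pieces are
    translates of one another. *)
Lemma sum_choices_all2 {S B : Type} {T : eqType} (G : S -> seq T)
    (r : T -> B -> bool) (t : seq S) (b : seq B) (K : B -> nat) :
  (forall x y, \sum_(u <- G x) r u y = K y) -> size t = size b ->
  \sum_(c <- choices [seq G x | x <- t]) all2 r c b = \prod_(y <- b) K y.
Proof.
move=> GK; elim: t b => [|x t IH] [|y b] //=.
  by rewrite big_seq1 big_nil.
move=> /succn_inj/IH {}IH; rewrite big_allpairs_dep /= big_cons -IH -(GK x) big_distrl /=.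
apply: eq_bigr => u _; rewrite big_distrr /=; apply: eq_bigr => c _.
by rewrite mulnb.
Qed.

End Subsequences.

(** * The pattern of a word *)

Section Patterns.
Local Open Scope nat_scope.

Lemma all2_nthP {S T : Type} (x0 : S) (y0 : T) (r : S -> T -> bool) s t :
  reflect (size s = size t /\
           forall i, i < size s -> r (nth x0 s i) (nth y0 t i)) (all2 r s t).
Proof.
elim: s t => [|x s IH] [|y t] /=; try by constructor; case.
  by constructor; split.
apply: (iffP andP) => [[rxy /IH[-> st]]|[[e] st]].
  by split=> // -[|i] //=; exact: st.
split; first exact: (st 0).
by apply/IH; split=> // i; exact: (st i.+1).
Qed.

Lemma order_isoP (w : seq nat) (p : permutation) :
  reflect (size w = plen p /\ forall i j, i < size w -> j < size w ->
     (nth 0 w i < nth 0 w j) = (nth 0 (word p) i < nth 0 (word p) j))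
  (order_iso w p).
Proof.
apply: (iffP andP) => -[].
  move=> /eqP sz /forallP h; split=> // i j; rewrite sz => lti ltj.
  have /forallP/(_ (Ordinal ltj))/eqP := h (Ordinal lti).
  by rewrite -!nth_word.
move=> sz h; split; first exact/eqP.
apply/forallP => i; apply/forallP => j; apply/eqP.
by rewrite h ?sz // !nth_word.
Qed.

Lemma size_order_iso {w p} : order_iso w p -> size w = plen p.
Proof. by case/andP => /eqP. Qed.

Lemma uniq_word (p : permutation) : uniq (word p).
Proof.
by rewrite map_inj_uniq ?enum_uniq // => i j /val_inj; exact: perm_inj.
Qed.

(** The value at [i] is recovered from comparisons alone, which is why a
    permutation is determined by its order relation. *)
Lemma perm_rank {n} (s : 'S_n) i : s i = #|[set j : 'I_n | s j < s i]%SET| :> nat.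
Proof.
have -> : [set j : 'I_n | s j < s i]%SET =
    (s @^-1: [set k : 'I_n | k < s i])%SET.
  by apply/setP => j; rewrite !inE.
rewrite card_preimset; last exact: perm_inj.
rewrite -sum1_card; under eq_bigl do rewrite inE.
rewrite -(big_ord_widen _ (fun=> 1)) ?(ltnW (ltn_ord _)) //.
by rewrite sum1_card card_ord.
Qed.

Lemma perm_order_inj {n} (s t : 'S_n) :
  (forall i j, (s i < s j) = (t i < t j)) -> s = t.
Proof.
move=> st; apply/permP => i; apply/val_inj => /=.
rewrite (perm_rank s) (perm_rank t).
by apply: eq_card => j; rewrite !inE st.
Qed.

Lemma order_iso_inj {w p q} : order_iso w p -> order_iso w q -> p = q.
Proof.
move=> /andP[/eqP szp hp] /andP[/eqP szq hq].
case: p q szp szq hp hq => [n s] [m t]; rewrite /plen /= => -> [e].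
rewrite /papp /=; subst m => /= hs ht; congr existT; apply: perm_order_inj => i j.
have /forallP/(_ j)/eqP <- := forallP hs i.
by have /forallP/(_ j)/eqP <- := forallP ht i.
Qed.

(** The pattern is the standardization: each entry is replaced with its rank,
    the number of smaller entries. *)
Lemma pattern_exists {w} : uniq w -> w != [::] -> exists p, order_iso w p.
Proof.
move=> uw; case wE : (size w) => [|n]; first by rewrite -size_eq0 wE.
move=> _; pose rk i := count (fun x => x < nth 0 w i) w.
have rk_lt i : i < n.+1 -> rk i < n.+1.
  move=> lti; rewrite -wE /rk -(count_predC (fun x => x < nth 0 w i)).
  rewrite -[X in X < _]addn0 ltn_add2l -has_count; apply/hasP.
  exists (nth 0 w i); first by rewrite mem_nth ?wE.
  by rewrite /= ltnn.
have rk_mono i j : i < n.+1 -> j < n.+1 -> nth 0 w i < nth 0 w j -> rk i < rk j.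
  move=> lti ltj ij; rewrite /rk.
  (* The entry of index [i] is below that of index [j] but not below itself. *)
  have -> : count (fun x => x < nth 0 w j) w =
     count (fun x => x < nth 0 w i) w +
     count (fun x => nth 0 w i <= x < nth 0 w j) w.
    rewrite -count_predUI [X in _ + X](_ : _ = 0) ?addn0.
      by apply: eq_count => x /=; lia.
    by rewrite -[RHS](count_pred0 w); apply: eq_count => x /=; lia.
  rewrite -[X in X < _]addn0 ltn_add2l -has_count; apply/hasP.
  by exists (nth 0 w i); rewrite ?mem_nth ?wE // leqnn.
pose f (i : 'I_n.+1) := Ordinal (rk_lt i (ltn_ord i)).
have rkE i j : i < n.+1 -> j < n.+1 -> (nth 0 w i < nth 0 w j) = (rk i < rk j).
  move=> lti ltj; apply/idP/idP; first exact: rk_mono.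
  have [//|/(rk_mono _ _ ltj lti)|e] := ltngtP (nth 0 w i) (nth 0 w j).
    by rewrite ltnNge => /negPf ne /ltnW; rewrite ne.
  by rewrite /rk e ltnn.
have f_inj : injective f.
  move=> i j /(congr1 val) /= e; apply/val_inj/eqP.
  rewrite -(nth_uniq 0 _ _ uw) ?wE; try exact: ltn_ord.
  have := rkE j i (ltn_ord j) (ltn_ord i).
  by have := rkE i j (ltn_ord i) (ltn_ord j); rewrite e ltnn; case: ltngtP.
exists (Tagged (fun n => 'S_n.+1) (perm f_inj)).
apply/andP; split; first by rewrite wE.
apply/forallP => i; apply/forallP => j; rewrite /papp /= !permE /=.
by rewrite rkE.
Qed.

Lemma patterns_exist {c} :
  all (fun w => uniq w && (w != [::])) c -> exists b, all2 order_iso c b.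
Proof.
elim: c => [|w c IH] /=; first by exists [::].
move=> /andP[/andP[uw w0] /IH[b cb]].
by have [p wp] := pattern_exists uw w0; exists (p :: b); rewrite /= wp.
Qed.

Lemma all2_order_iso_inj {c b b'} :
  all2 order_iso c b -> all2 order_iso c b' -> b = b'.
Proof.
elim: c b b' => [|w c IH] [|p b] [|q b'] //= /andP[wp cb] /andP[wq cb'].
by rewrite (order_iso_inj wp wq) (IH b b').
Qed.

Lemma shape_order_iso {c b} : all2 order_iso c b -> shape c = map plen b.
Proof.
by elim: c b => [|w c IH] [|p b] //= /andP[/size_order_iso -> /IH ->].
Qed.

End Patterns.

(** * Inflations and patterns of concatenations *)

Section Inflations.
Local Open Scope nat_scope.

(** Comparing entries of different blocks only depends on the blocks, and is
    read off from [t]; nothing is said about entries of the same block. *)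
Definition arranged (t : seq nat) (c : seq (seq nat)) : Prop :=
  size c = size t /\
  forall i j u v, i != j -> u \in nth [::] c i -> v \in nth [::] c j ->
    (u < v) = (nth 0 t i < nth 0 t j).

Lemma mem_nth_nil {T : eqType} {c : seq (seq T)} {i u} :
  u \in nth [::] c i -> i < size c.
Proof. by case: ltnP => // le; rewrite nth_default. Qed.

Lemma nth_flatten_index {T : Type} (x0 : T) (c : seq (seq T)) i k :
  k < size (nth [::] c i) ->
  nth x0 (flatten c) (flatten_index (shape c) i k) = nth x0 (nth [::] c i) k.
Proof.
move=> kc; have ks : k < nth 0 (shape c) i.
  have [ic|ic] := ltnP i (size c); last by rewrite nth_default in kc.
  by rewrite (nth_map [::]).
by rewrite nth_flatten flatten_indexKl // flatten_indexKr.
Qed.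

(** The transversal condition in the definition of an inflation amounts to a
    condition on pairs of entries from two different blocks, because any such
    pair extends to a transversal: no block is empty. *)
Lemma inflationP (sigma : permutation) (b : seq permutation) (pi : permutation) :
  is_inflation sigma b pi <->
  exists c, [/\ flatten c = word pi, size b = plen sigma, all2 order_iso c b
              & arranged (word sigma) c].
Proof.
split=> [[szb len blk trans]|[c [fc szb cb [szc ar]]]].
  exists (reshape (map plen b) (word pi)); split=> //.
    by rewrite reshapeKr // size_word len.
  set c := reshape _ _ in blk trans *.
  have shc : shape c = map plen b by rewrite reshapeKl // size_word len.
  have szc : size c = plen sigma.
    by rewrite -(size_map size c) -/(shape c) shc size_map.
  split=> [|i j u v ij ui vj]; first by rewrite size_word.
  (* A transversal through [u] and [v], completed by first entries. *)
  pose x := mkseq (fun r => if r == i then u else if r == j then v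
                            else nth 0 (nth [::] c r) 0) (size c).
  have [ic jc] := (mem_nth_nil ui, mem_nth_nil vj).
  have /order_isoP[_ /(_ i j)] : order_iso x sigma.
    apply: trans; apply/(all2_nthP 0 [::]); split; first by rewrite size_mkseq.
    move=> r; rewrite size_mkseq => rc; rewrite nth_mkseq //.
    case: eqVneq => [->//|_]; case: eqVneq => [->//|_]; apply: mem_nth.
    by rewrite -(nth_map [::] 0 size) // -/(shape c) shc (nth_map pi) // szb -szc.
  rewrite size_mkseq !nth_mkseq // eqxx [j == i]eq_sym (negPf ij) eqxx.
  by apply.
have shc := shape_order_iso cb.
have rc : reshape (map plen b) (word pi) = c by rewrite -fc -shc flattenK.
split; rewrite ?rc //; first by rewrite -size_word -fc size_flatten shc.
move=> x /(all2_nthP 0 [::])[szx xc]; apply/order_isoP.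
rewrite szx szc size_word; split=> // i j ilt jlt.
have [->|ij] := eqVneq i j; first by rewrite !ltnn.
by apply: ar => //; apply: xc; rewrite szx szc size_word.
Qed.

(** The order relation of a concatenation splits into comparisons inside a
    block, which are fixed by [b], and comparisons across blocks, which are fixed
    by [sigma]; so [sigma[b_1, ..., b_l]] is its only possible pattern. *)
Lemma order_iso_flatten (t : seq nat) (c : seq (seq nat)) (sigma : permutation)
    (b : seq permutation) (pi : permutation) :
  arranged t c -> order_iso t sigma -> all2 order_iso c b ->
  order_iso (flatten c) pi <-> is_inflation sigma b pi.
Proof.
move=> [szc ar] /order_isoP[szt ot] cb; have shc := shape_order_iso cb.
have /(all2_nthP [::] pi)[szcb ob] := cb.
split.
  move=> /order_isoP[sz o]; apply/inflationP.
  (* Transport the blocks of [c] to the word of [pi], position by position. *)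
  pose c' := reshape (shape c) (word pi).
  have fc' : flatten c' = word pi.
    by rewrite reshapeKr // size_word -sz size_flatten.
  have shc' : shape c' = shape c.
    by rewrite reshapeKl // size_word -sz size_flatten.
  have szc' : size c' = size c.
    by rewrite -(size_map size c') -/(shape c') shc' size_map.
  have szi i : size (nth [::] c' i) = size (nth [::] c i).
    have [ic|ic] := ltnP i (size c); last by rewrite !nth_default ?szc'.
    by rewrite -!(nth_map [::] 0 size) ?szc' // -!/(shape _) shc'.
  have bw i j k l : k < size (nth [::] c i) -> l < size (nth [::] c j) ->
    (nth 0 (nth [::] c' i) k < nth 0 (nth [::] c' j) l) =
    (nth 0 (nth [::] c i) k < nth 0 (nth [::] c j) l).
    have idx r q : q < size (nth [::] c r) ->
        flatten_index (shape c) r q < size (flatten c).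
      move=> qr; rewrite size_flatten flatten_indexP //.
      have [rc|rc] := ltnP r (size c); last by rewrite nth_default in qr.
      by rewrite (nth_map [::]).
    move=> ki lj; rewrite -!(nth_flatten_index _ c) // o ?idx // -fc' -shc'.
    by rewrite !nth_flatten_index ?szi.
  exists c'; split=> //; first by rewrite -szcb szc.
    apply/(all2_nthP [::] pi); split; first by rewrite szc'.
    move=> i; rewrite szc' => ic; have /order_isoP[si oi] := ob i ic.
    apply/order_isoP; rewrite szi; split=> // k l kl ll.
    by rewrite bw // oi.
  split=> [|i j u v ij ui vj]; first by rewrite szc' szc size_word.
  have ic : i < size t by rewrite -szc -szc'; exact: mem_nth_nil ui.
  have jc : j < size t by rewrite -szc -szc'; exact: mem_nth_nil vj.
  move: ui vj => /(nthP 0)[k ki <-] /(nthP 0)[l lj <-].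
  rewrite szi in ki; rewrite szi in lj; rewrite bw // -ot //.
  by apply: ar; rewrite // mem_nth.
move=> /inflationP[c' [fc' szb cb' [szc' ar']]].
have shc' := shape_order_iso cb'.
have /(all2_nthP [::] pi)[szcb' ob'] := cb'.
have szi i : size (nth [::] c' i) = size (nth [::] c i).
  have [ic|ic] := ltnP i (size c); last by rewrite !nth_default // szcb' -szcb.
  by rewrite -!(nth_map [::] 0 size) ?szcb' -?szcb // -!/(shape _) shc shc'.
apply/order_isoP; rewrite -size_word -fc' !size_flatten shc shc'.
split=> // i j; rewrite -shc => isz jsz; rewrite !nth_flatten shc' -shc.
have := reshape_offsetP isz; have := reshape_offsetP jsz.
have := reshape_indexP isz; have := reshape_indexP jsz.
move: (reshape_index _ i) (reshape_index _ j).
move=> r s; move: (reshape_offset _ i) (reshape_offset _ j) => k l; rewrite size_map => sc rc; rewrite !(nth_map [::]) // => ls kr.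
have [e|rs] := eqVneq r s.
  subst s; have /order_isoP[_ ->] := ob r rc; rewrite ?size_order_iso //.
  have rc' : r < size c' by rewrite szcb' -szcb.
  by have /order_isoP[_ ->] := ob' r rc'; rewrite ?szi.
rewrite -szi in kr; rewrite -szi in ls.
rewrite (ar' r s _ _ rs (mem_nth 0 kr) (mem_nth 0 ls)).
rewrite !szi in kr ls; rewrite (ar r s _ _ rs (mem_nth 0 kr) (mem_nth 0 ls)).
by rewrite ot // -szc.
Qed.

(** The pair made of the pattern of [t] and the patterns of the blocks is the
    only term of the sum that can be nonzero. *)
Lemma order_iso_flatten_sum (t : seq nat) (c : seq (seq nat)) (pi : permutation) :
  uniq t -> t != [::] -> all (fun w => uniq w && (w != [::])) c ->
  arranged t c ->
  order_iso (flatten c) pi =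
  \sum_(d <- fset_set (block_decompositions pi))
    (order_iso t d.1 && all2 order_iso c d.2) :> nat.
Proof.
move=> ut t0 cP ar.
have [sigma ts] := pattern_exists ut t0; have [b cb] := patterns_exist cP.
have -> : order_iso (flatten c) pi =
    ((sigma, b) \in fset_set (block_decompositions pi)).
  rewrite in_fset_set; last exact: finite_block_decompositions.
  have [to from] := order_iso_flatten t c sigma b pi ar ts cb.
  by apply/idP/idP; rewrite in_setE.
rewrite -count_uniq_mem ?fset_uniq // -sum1_count big_mkcond /=.
apply: eq_bigr => -[s b'] _ /=.
case: andP => [[ts' cb']|ne].
  by rewrite (order_iso_inj ts' ts) (all2_order_iso_inj cb' cb) eqxx.
by case: eqP => // -[? ?]; subst; case: ne.
Qed.

End Inflations.

(** * Counting occurrences in a tensor product *)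

Section Occurrences.
Local Open Scope nat_scope.

Definition occurrences (p : permutation) (w : seq nat) : nat :=
  \sum_(u <- subs w) order_iso u p.

Lemma occurrences_affine (p : permutation) (x m : nat) (w : seq nat) :
  \sum_(u <- nonempty_subs [seq x * m + y | y <- w]) order_iso u p =
  occurrences p w.
Proof.
(* Permutations have positive length, so the empty subsequence adds nothing. *)
have nil0 : order_iso [::] p = false by [].
rewrite -[LHS]add0n -[X in X + _]/(false : nat) -nil0.
rewrite -(sum_subs_nil _ (fun u => order_iso u p : nat)) subs_map big_map.
apply: eq_bigr => u _; congr nat_of_bool.
apply/order_isoP/order_isoP; rewrite size_map => -[sz o]; split=> // i j ilt jlt.
  by rewrite -o // !(nth_map 0) // ltn_add2l.
by rewrite -o // !(nth_map 0) // ltn_add2l.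
Qed.

(** A finite, exact form of the theorem. *)
Lemma occurrences_tensor (tau gamma pi : permutation) :
  occurrences pi (word (tensor tau gamma)) =
  \sum_(d <- fset_set (block_decompositions pi))
    occurrences d.1 (word tau) * \prod_(b <- d.2) occurrences b (word gamma).
Proof.
rewrite /occurrences word_tensor.
pose G x := [seq x * plen gamma + y | y <- word gamma].
rewrite (sum_subs_flatten G (word tau) (fun u => order_iso u pi : nat)).
under [RHS]eq_bigr do rewrite big_distrl /=.
rewrite [RHS]exchange_big /= !big_seq; apply: eq_bigr => t.
rewrite mem_subs => tw; have ut := subseq_uniq tw (uniq_word tau).
have [->|t0] := eqVneq t [::].
  by rewrite /= big_seq1 /=; apply/esym/big1.
transitivity (\sum_(c <- choices [seq nonempty_subs (G x) | x <- t])
   \sum_(d <- fset_set (block_decompositions pi))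
     (order_iso t d.1 && all2 order_iso c d.2)).
  rewrite !big_seq; apply: eq_bigr => c /mem_choices.
  move=> /(all2_nthP [::] [::]); rewrite size_map => -[szc cP].
  have cS i : i < size c -> subseq (nth [::] c i) (G (nth 0 t i)) &&
      (nth [::] c i != [::]).
    move=> ic; have := cP i ic; rewrite (nth_map 0) -?szc //.
    by rewrite mem_filter mem_subs andbC.
  have cG i u : u \in nth [::] c i ->
      exists2 y, y < plen gamma & u = nth 0 t i * plen gamma + y.
    move=> ui; have /andP[/mem_subseq/(_ _ ui)] := cS i (mem_nth_nil ui).
    by move=> /mapP[y /mapP[k _ ->] ->] _; exists (papp gamma k).
  apply: order_iso_flatten_sum => //.
    apply/(all_nthP [::]) => i ic; have /andP[sub ->] := cS i ic.
    rewrite andbT (subseq_uniq sub) // map_inj_uniq ?uniq_word //.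
    by move=> y z /addnI.
  split=> // i j u v ij ui vj.
  have : nth 0 t i != nth 0 t j.
    by rewrite nth_uniq // -szc ?(mem_nth_nil ui) ?(mem_nth_nil vj).
  have [y ym ->] := cG i u ui; have [z zm ->] := cG j v vj.
  (* Translates by distinct multiples of [plen gamma] do not overlap. *)
  by move: (nth 0 t i) (nth 0 t j) => a b; nia.
rewrite exchange_big !big_seq; apply: eq_bigr => -[s b] /=.
rewrite in_fset_set; last exact: finite_block_decompositions.
rewrite in_setE => -[/= szb _ _ _].
under eq_bigr do rewrite -mulnb.
rewrite -big_distrr /=; case: (boolP (order_iso t s)) => // /size_order_iso szt.
congr (_ * _); apply: sum_choices_all2; last by rewrite szb szt.
by move=> x p; exact: occurrences_affine.
Qed.

Lemma sum_subs_set {T : finType} (F : seq T -> nat) :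
  \sum_(A : {set T}) F (enum A) = \sum_(u <- subs (enum T)) F u.
Proof.
rewrite -(big_map (fun A : {set T} => enum A) predT F); apply: perm_big.
apply: uniq_perm.
- rewrite map_inj_uniq ?index_enum_uniq // => A B AB.
  by apply/setP => x; rewrite -(mem_enum A) AB mem_enum.
- exact/subs_uniq/enum_uniq.
move=> u; rewrite mem_subs; apply/mapP/idP => [[A _ ->]|].
  by rewrite enumT {1}/enum_mem; exact: filter_subseq.
move=> /subseq_uniqP -/(_ (enum_uniq _)) uE; exists [set x in u]%SET.
  exact: mem_index_enum.
by rewrite {1}uE enumT /enum_mem; apply: eq_filter => x; rewrite [RHS]inE.
Qed.

Lemma card_occurrences (pi tau : permutation) :
  #|[set A : {set 'I_(plen tau)} |
      (#|A| == plen pi) && order_iso (restriction A) pi]%SET| =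
  occurrences pi (word tau).
Proof.
rewrite /occurrences /word subs_map big_map.
rewrite -(sum_subs_set
  (fun u => order_iso [seq val (papp tau i) | i <- u] pi : nat)).
rewrite -sum1_card big_mkcond; apply: eq_bigr => A _; rewrite inE -/(restriction A).
have -> : #|A| = size (restriction A) by rewrite size_map cardE.
by case: (boolP (order_iso _ _)) => [/size_order_iso->|]; rewrite ?eqxx ?andbF.
Qed.

Lemma occurrences_small (pi tau : permutation) :
  plen tau < plen pi -> occurrences pi (word tau) = 0.
Proof.
move=> lt; rewrite -card_occurrences; apply: eq_card0 => A; rewrite !inE.
rewrite eqn_leq [plen pi <= _]leqNgt (leq_ltn_trans _ lt) ?andbF //.
by rewrite -[X in _ <= X]card_ord max_card.
Qed.

End Occurrences.

(** * Passage to the limit *)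

Section Limits.
Local Open Scope classical_set_scope.
Local Open Scope ring_scope.

Lemma densityE {R : realType} (pi tau : permutation) :
  density R pi tau = (occurrences pi (word tau))%:R / 'C(plen tau, plen pi)%:R.
Proof. by rewrite /density card_occurrences. Qed.

(** When [tau] is shorter than [pi] both sides vanish, so dividing by a zero
    binomial coefficient does no harm. *)
Lemma binomial_density {R : realType} (pi tau : permutation) :
  'C(plen tau, plen pi)%:R * density R pi tau = (occurrences pi (word tau))%:R.
Proof.
rewrite densityE; have [lt|le] := ltnP (plen tau) (plen pi).
  by rewrite occurrences_small // mul0r mulr0.
by rewrite mulrC divfK // pnatr_eq0 -lt0n bin_gt0.
Qed.

(** By induction on [k], from
    [k.+1 * 'C(m, k.+1) = (m - k) * 'C(m, k)] and [(m - k) / m --> 1]. *)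
Lemma cvg_binomial_expn {R : realType} (k : nat) :
  ('C(m, k)%:R / m%:R ^+ k : R) @[m --> \oo] --> (k`!%:R : R)^-1.
Proof.
elim: k => [|k IH].
  under eq_fun do rewrite bin0 expr0 divr1.
  by rewrite fact0 invr1; exact: cvg_cst.
have sub_cvg : ((m - k)%:R / m%:R : R) @[m --> \oo] --> (1 : R).
  have inv_cvg : (m%:R^-1 : R) @[m --> \oo] --> (0 : R).
    apply/gtr0_cvgV0; last exact: cvgr_idn.
    by near=> m; rewrite ltr0n; near: m; exact: nbhs_infty_gt.
  have : (1 - k%:R * m%:R^-1 : R) @[m --> \oo] --> (1 - k%:R * 0 : R).
    by apply: cvgB; [exact: cvg_cst|apply: cvgM; [exact: cvg_cst|]].
  rewrite mulr0 subr0; apply: cvg_trans; apply: near_eq_cvg; near=> m.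
  have km : (k < m)%N by near: m; exact: nbhs_infty_gt.
  rewrite natrB ?(ltnW km) // mulrBl divff // pnatr_eq0 -lt0n.
  exact: leq_ltn_trans km.
have -> : (fun m => 'C(m, k.+1)%:R / m%:R ^+ k.+1 : R) =
    (fun m => k.+1%:R^-1 * (('C(m, k)%:R / m%:R ^+ k) * ((m - k)%:R / m%:R))).
  apply/funext => m; apply: (@mulfI _ k.+1%:R); first by rewrite pnatr_eq0.
  rewrite mulVKf ?pnatr_eq0 // [LHS]mulrA -natrM mul_bin_left natrM exprSr.
  by rewrite invfM [_%:R * _]mulrC [RHS]mulrACA.
rewrite factS natrM invfM; apply: cvgM; first exact: cvg_cst.
by rewrite -[X in _ --> X]mulr1; exact: cvgM.
Unshelve. all: by end_near. Qed.

Lemma sumn_block_decomposition (pi : permutation) d :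
  block_decompositions pi d -> sumn (map plen d.2) = plen pi.
Proof. by case=> _ ->. Qed.

Lemma cvg_occurrences {R : realType} (gamma : nat -> permutation) (b : permutation) :
  convergent R gamma ->
  ((occurrences b (word (gamma j)))%:R / (plen (gamma j))%:R ^+ plen b : R)
    @[j --> \oo] --> (limit_density R b gamma / (plen b)`!%:R).
Proof.
move=> [len_cvg dens_cvg].
under eq_fun do rewrite -binomial_density [X in X / _]mulrC -mulrA.
apply: cvgM; first exact: dens_cvg.
exact: (cvg_comp _ _ len_cvg (cvg_binomial_expn (plen b))).
Qed.

Lemma prod_expr_sumn {R : realType} (s : seq nat) (x : R) :
  \prod_(i <- s) x ^+ i = x ^+ sumn s.
Proof. by elim: s => [|i s IH]; rewrite ?big_nil ?big_cons //= IH exprD. Qed.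

(** The exact identity, normalized so that each factor has a limit when the
    length of [gamma] tends to infinity. *)
Lemma density_tensor {R : realType} (pi tau gamma : permutation) :
  density R pi (tensor tau gamma) =
  ('C(plen tau * plen gamma, plen pi)%:R /
     (plen tau * plen gamma)%:R ^+ plen pi)^-1 * (plen tau)%:R ^- plen pi *
  \sum_(d <- fset_set (block_decompositions pi))
    ('C(plen tau, plen d.1)%:R * density R d.1 tau *
     \prod_(b <- d.2) ((occurrences b (word gamma))%:R /
                       (plen gamma)%:R ^+ plen b)).
Proof.
have nz p : (plen p)%:R != 0 :> R by rewrite pnatr_eq0.
rewrite densityE occurrences_tensor natr_sum.
rewrite [plen (tensor tau gamma)]/(plen tau * plen gamma)%N.
set S := (X in _ = _ * X).
(* The lengths of the blocks add up to [plen pi]. *)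
have -> : (\sum_(d <- fset_set (block_decompositions pi))
    (occurrences d.1 (word tau) *
      \prod_(b <- d.2) occurrences b (word gamma))%N%:R) =
    (plen gamma)%:R ^+ plen pi * S.
  rewrite mulr_sumr !big_seq; apply: eq_bigr => d.
  rewrite in_fset_set; last exact: finite_block_decompositions.
  rewrite in_setE => /sumn_block_decomposition <-.
  rewrite natrM natr_prod binomial_density mulrCA; congr (_ * _).
  rewrite big_split /= prodfV -prod_expr_sumn big_map mulrCA divff ?mulr1 //.
  by rewrite prodf_seq_neq0; apply/allP => b _; rewrite expf_neq0.
rewrite invfM invrK natrM exprMn [_ ^+ _ * _ ^+ _]mulrC [_^-1 * (_ * _)]mulrA.
by rewrite mulfK ?expf_neq0 // [LHS]mulrC mulrA.
Qed.

Lemma plen_tensor_cvg (tau : permutation) (gamma : nat -> permutation) :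
  plen (gamma j) @[j --> \oo] --> \oo ->
  (plen tau * plen (gamma j))%N @[j --> \oo] --> \oo.
Proof.
move=> /cvgnyPge gamma_ge; apply/cvgnyPge => A.
by apply: filterS (gamma_ge A) => j le; apply: leq_trans le _; exact: leq_pmull.
Qed.

Lemma cvg_density_tensor {R : realType} (tau : permutation) (gamma : nat -> permutation)
    (pi : permutation) :
  convergent R gamma ->
  density R pi (tensor tau (gamma j)) @[j --> \oo] -->
    ((plen pi)`!%:R / (plen tau)%:R ^+ plen pi *
     \sum_(d \in block_decompositions pi)
       ('C(plen tau, plen d.1)%:R * density R d.1 tau *
        \prod_(b <- d.2) (limit_density R b gamma / (plen b)`!%:R)) : R).
Proof.
move=> gamma_cvg; have [len_cvg _] := gamma_cvg.
rewrite fsbig_finite; last exact: finite_block_decompositions.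
under eq_fun do rewrite density_tensor.
apply: cvgM.
  apply: cvgM; last exact: cvg_cst.
  rewrite -[X in _ --> X]invrK; apply: cvgV.
    by rewrite invr_eq0 pnatr_eq0 -lt0n fact_gt0.
  exact: (cvg_comp _ _ (plen_tensor_cvg tau _ len_cvg)
                       (cvg_binomial_expn (plen pi))).
apply: cvg_big => [|d _]; first exact: add_continuous.
apply: cvgM; first exact: cvg_cst.
apply: cvg_big => [|b _]; first exact: mul_continuous.
exact: cvg_occurrences.
Qed.

End Limits.

Local Open Scope classical_set_scope.
Local Open Scope ring_scope.

Theorem theorem7 (R : realType) (tau : permutation) (gamma : nat -> permutation)
    (gamma_cvg : convergent R gamma) :
  convergent R (fun j => tensor tau (gamma j)) /\
  forall pi : permutation,
    limit_density R pi (fun j => tensor tau (gamma j)) =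
    (plen pi)`!%:R / (plen tau)%:R ^+ plen pi *
    \sum_(d \in block_decompositions pi)
      ('C(plen tau, plen d.1)%:R * density R d.1 tau *
       \prod_(b <- d.2) (limit_density R b gamma / (plen b)`!%:R)).
Proof.
have lim pi := @cvg_density_tensor R tau gamma pi gamma_cvg.
split=> [|pi]; last exact/cvg_lim/lim.
split=> [|pi]; first exact: plen_tensor_cvg (proj1 gamma_cvg).
by apply/cvg_ex; eexists; exact: lim.
Qed.
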